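(* Let $d\ge1$ be an integer. Quasi-all functions $f\in L^1(\mathcal S_d)$ satisfy $\beta^+_{\rm HF}(x)\le0$ for all $x\in\mathcal S_d$.
   Context: $\mathcal S_d$ is the Euclidean unit sphere of $\mathbb R^{d+1}$ and $d\sigma$ its normalized Lebesgue measure. For $f\in L^1(\mathcal S_d)$, the Poisson integral of $f$ is the harmonic function on the open unit ball given by $$P[f](x)=\int_{\mathcal S_d}P(x,\xi)f(\xi)\,d\sigma(\xi),\qquad P(x,\xi)=\frac{1-\|x\|^2}{\|x-\xi\|^{d+1}} .$$ For $x\in\mathcal S_d$, $\beta^+_{\rm HF}(x)$ (depending on $f$) is the supremum of the real numbers $\beta$ such that $(1-r)^{-\beta}=O\big(P[f](rx)\big)$ as $r\to1^-$, i.e. $\beta^+_{\rm HF}(x)=\liminf_{r\to1}\frac{\log|P[f](rx)|}{-\log(1-r)}$ (with $\log 0=-\infty$). ''Quasi-all'' means: for all $f$ in a residual subset (one containing a countable intersection of dense open sets). *)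

(* Defs.v *)
From HB Require Import structures.
From mathcomp Require Import all_boot all_order all_algebra.
From mathcomp Require Import all_classical all_reals all_analysis.
From mathcomp Require Import measurable_realfun borel_hierarchy.

Set Implicit Arguments.
Unset Strict Implicit.
Unset Printing Implicit Defensive.

Import Order.TTheory GRing.Theory Num.Theory.
Import numFieldNormedType.Exports.

Local Open Scope classical_set_scope.
Local Open Scope ring_scope.

(* Row vectors 'rV[R]_n carry the product sigma-algebra generated by the n
   coordinates, as n.-tuple R does in the library; it is the Borel one. *)
Definition rV_display : measure_display. Proof. by constructor. Qed.

Section rV_measurable.
Variables (R : realType) (n : nat).

Definition rV_coord (i : 'I_n) (x : 'rV[R]_n) : measurableTypeR R := x 0 i.

Let rV_set0 : g_sigma_preimage rV_coord set0.
Proof. exact: sigma_algebra0. Qed.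

Let rV_setC A : g_sigma_preimage rV_coord A -> g_sigma_preimage rV_coord (~` A).
Proof. exact: sigma_algebraC. Qed.

Let rV_bigcup (F : _^nat) : (forall i, g_sigma_preimage rV_coord (F i)) ->
  g_sigma_preimage rV_coord (\bigcup_i (F i)).
Proof. exact: sigma_algebra_bigcup. Qed.

HB.instance Definition _ := @isMeasurable.Build rV_display 'rV[R]_n
  (g_sigma_preimage rV_coord) rV_set0 rV_setC rV_bigcup.

Lemma measurable_coord (i : 'I_n) : measurable_fun setT (rV_coord i).
Proof.
move=> _ Y mY; rewrite setTI; apply: sub_sigma_algebra => /=.
rewrite -bigcup_seq/=; exists i => /=; first by rewrite mem_index_enum.
by exists Y => //; rewrite setTI.
Qed.

Lemma measurable_rV d (T : measurableType d) (f : T -> 'rV[R]_n) :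
  (forall i, measurable_fun setT (rV_coord i \o f)) -> measurable_fun setT f.
Proof.
move=> mf _ A mA.
suff : preimage_set_system setT f (g_sigma_preimage rV_coord) `<=` measurable.
  by apply; exists A.
rewrite -g_sigma_preimage_comp; apply: smallest_sub.
  exact: sigma_algebra_measurable.
by rewrite -bigcup_seq; apply: bigcup_sub => i _ B [C mC <-]; exact: mf.
Qed.

End rV_measurable.

Definition rV_cons (R : realType) (n : nat) (p : measurableTypeR R * 'rV[R]_n) :
  'rV[R]_n.+1 := row_mx (const_mx p.1 : 'rV_1) p.2.

(* n-dimensional Lebesgue measure (on Borel sets), as an iterated product:
   R^(m.+1) is identified with R * R^m through rV_cons, and R^0 is a point.
   lebesgue_rV_cube below computes it on cubes. *)
Fixpoint lebesgue_rV (R : realType) (n : nat) : set 'rV[R]_n -> \bar R :=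
  match n return set 'rV[R]_n -> \bar R with
  | 0 => \d_(0 : 'rV[R]_0)
  | m.+1 => pushforward (lebesgue_measure \x @lebesgue_rV R m)%E (@rV_cons R m)
  end.

Section lebesgue_rV_measure.
Variable R : realType.

Lemma measurable_rV_cons n : measurable_fun setT (@rV_cons R n).
Proof.
apply: measurable_rV => i; case: (@splitP 1 n i) => j ij.
  rewrite (_ : _ \o _ = fst)//; apply/funext => p /=; rewrite /rV_coord /rV_cons.
  rewrite (_ : i = lshift n j); last exact/val_inj.
  by rewrite (row_mxEl (const_mx p.1 : 'rV_1)) mxE.
rewrite (_ : _ \o _ = rV_coord j \o snd).
  by apply: measurableT_comp => //; exact: measurable_coord.
apply/funext => p /=; rewrite /rV_coord /rV_cons.
rewrite (_ : i = rshift 1 j); last exact/val_inj.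
by rewrite (row_mxEr (const_mx p.1 : 'rV_1)).
Qed.

Definition rV_uncons n (x : 'rV[R]_n.+1) : measurableTypeR R * 'rV[R]_n :=
  (x 0 0, rsubmx (x : 'rV_(1 + n))).

Lemma measurable_rV_uncons n : measurable_fun setT (@rV_uncons n).
Proof.
apply: measurable_fun_pair; first exact: (@measurable_coord R n.+1 ord0).
apply: measurable_rV => i.
rewrite (_ : _ \o _ = rV_coord (rshift 1 i)); first exact: measurable_coord.
by apply/funext => x /=; rewrite /rV_coord mxE.
Qed.

Lemma rV_consK n : cancel (@rV_cons R n) (@rV_uncons n).
Proof.
case=> a x; rewrite /rV_uncons /rV_cons (row_mxKr (const_mx a : 'rV_1)) /=.
congr pair.
rewrite (_ : 0 = lshift n (0 : 'I_1)); last exact/val_inj.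
by rewrite (row_mxEl (const_mx a : 'rV_1)) mxE.
Qed.

Lemma rV_unconsK n : cancel (@rV_uncons n) (@rV_cons R n).
Proof.
move=> x; rewrite /rV_cons /rV_uncons /=.
apply/rowP => i; case: (@splitP 1 n i) => j ij.
  rewrite (_ : i = lshift n j); last exact/val_inj.
  by rewrite (row_mxEl (const_mx (x 0 0) : 'rV_1)) mxE ord1; congr (x _ _); exact/val_inj.
rewrite (_ : i = rshift 1 j); last exact/val_inj.
by rewrite (row_mxEr (const_mx (x 0 0) : 'rV_1)) mxE.
Qed.

Section step.
Variables (n : nat) (m : {sigma_finite_measure set 'rV[R]_n -> \bar R}).

Definition rV_cons_measure := pushforward (lebesgue_measure \x m)%E (@rV_cons R n).

Let M : {measure set 'rV[R]_n.+1 -> \bar R} :=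
  measure_function_pushforward__canonical__measure_function_Measure
    (lebesgue_measure \x m)%E (@measurable_rV_cons n).

HB.instance Definition _ := isMeasure.Build _ _ _ rV_cons_measure
  (measure0 M) (measure_ge0 M) (@measure_semi_sigma_additive _ _ _ M).

Let rV_cons_sigma_finite : sigma_finite setT rV_cons_measure.
Proof.
have /sigma_finiteP[F [TF ndF Foo]] := sigma_finiteT (@lebesgue_measure R).
have /sigma_finiteP[G [TG ndG Goo]] := sigma_finiteT m.
exists (fun k => @rV_uncons n @^-1` (F k `*` G k)).
  rewrite -preimage_bigcup (_ : \bigcup_k _ = setT) ?preimage_setT//.
  apply/seteqP; split => // -[x y] _.
  have [k _ Fx] : (\bigcup_k F k) x by rewrite -TF.
  have [l _ Gy] : (\bigcup_k G k) y by rewrite -TG.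
  exists (maxn k l) => //; split.
    by move: x Fx; exact/subsetPset/ndF/leq_maxl.
  by move: y Gy; exact/subsetPset/ndG/leq_maxr.
move=> k; have [mF Fk] := Foo k; have [mG Gk] := Goo k; split.
  rewrite -[X in measurable X]setTI; apply: measurable_rV_uncons => //.
  exact: measurableX.
rewrite /rV_cons_measure /pushforward -comp_preimage.
rewrite (_ : _ \o _ = id); last by apply/funext => p; exact: rV_consK.
by rewrite preimage_id product_measure1E// lte_mul_pinfty// ge0_fin_numE.
Qed.

HB.instance Definition _ := @Measure_isSigmaFinite.Build _ _ _ rV_cons_measure
  rV_cons_sigma_finite.

End step.

Lemma lebesgue_rV_subproof n :
  exists m : {sigma_finite_measure set 'rV[R]_n -> \bar R}, @lebesgue_rV R n = m.
Proof.
elim: n => [|n [m mE]]; first by exists \d_(0 : 'rV[R]_0).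
by exists (@rV_cons_measure n m); rewrite /= mE.
Qed.

Section instances.
Variable n : nat.

Let lebesgue_rV0 : @lebesgue_rV R n set0 = 0%E.
Proof. by have [m ->] := lebesgue_rV_subproof n; exact: measure0. Qed.

Let lebesgue_rV_ge0 A : (0 <= @lebesgue_rV R n A)%E.
Proof. by have [m ->] := lebesgue_rV_subproof n; exact: measure_ge0. Qed.

Let lebesgue_rV_sigma_additive : semi_sigma_additive (@lebesgue_rV R n).
Proof.
by have [m ->] := lebesgue_rV_subproof n; exact: measure_semi_sigma_additive.
Qed.

Let lebesgue_rV_sigma_finite : sigma_finite setT (@lebesgue_rV R n).
Proof. by have [m ->] := lebesgue_rV_subproof n; exact: sigma_finiteT. Qed.

HB.instance Definition _ := isMeasure.Build _ _ _ (@lebesgue_rV R n)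
  lebesgue_rV0 lebesgue_rV_ge0 lebesgue_rV_sigma_additive.

HB.instance Definition _ := @Measure_isSigmaFinite.Build _ _ _ (@lebesgue_rV R n)
  lebesgue_rV_sigma_finite.

End instances.

Lemma measurable_rV_cube n (i : interval R) :
  measurable [set x : 'rV[R]_n | forall j, x 0 j \in i].
Proof.
rewrite (_ : mkset _ = \bigcap_(j in [set: 'I_n]) (rV_coord j @^-1` [set` i])).
  apply: fin_bigcap_measurable => // j _.
  by rewrite -[X in measurable X]setTI; exact: measurable_coord.
by apply/seteqP; split => x Hx j //=; [move=> _; exact: Hx|exact: (Hx j)].
Qed.

Lemma lebesgue_rV_cube n (i : interval R) :
  @lebesgue_rV R n [set x | forall j, x 0 j \in i] =
  (lebesgue_measure [set` i] ^+ n)%E.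
Proof.
elim: n => [|n IH].
  by rewrite /= diracE mem_set//= => -[].
rewrite expeS -IH -product_measure1E//; last exact: measurable_rV_cube.
rewrite /= /pushforward; congr (_ _); apply/seteqP; split => [p /= H|p /= [H1 H2] j].
  split.
    have := H (lshift n (0 : 'I_1)).
    by rewrite /rV_cons (row_mxEl (const_mx p.1 : 'rV_1)) mxE.
  move=> j; have := H (rshift 1 j).
  by rewrite /rV_cons (row_mxEr (const_mx p.1 : 'rV_1)).
rewrite /rV_cons; case: (@splitP 1 n j) => k jk.
  rewrite (_ : j = lshift n k); last exact/val_inj.
  by rewrite (row_mxEl (const_mx p.1 : 'rV_1)) mxE.
rewrite (_ : j = rshift 1 k); last exact/val_inj.
by rewrite (row_mxEr (const_mx p.1 : 'rV_1)).
Qed.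

End lebesgue_rV_measure.

(* Euclidean norm; the library norm `|x| on 'rV[R]_n is the max norm. *)
Definition enorm (R : realType) (n : nat) (x : 'rV[R]_n) : R :=
  Num.sqrt (\sum_(i < n) x 0 i ^+ 2).

Definition eball (R : realType) (n : nat) : set 'rV[R]_n := [set x | enorm x < 1].

Section eball_measure.
Variables (R : realType) (n : nat).

Lemma measurable_enorm : measurable_fun setT (@enorm R n).
Proof.
apply: (measurableT_comp (f := @Num.sqrt R)).
  apply: continuous_measurable_fun; exact: sqrt_continuous.
apply: measurable_sum => i; apply: measurable_funX; exact: measurable_coord.
Qed.

Lemma measurable_eball : measurable (@eball R n).
Proof.
rewrite (_ : @eball R n = @enorm R n @^-1` `]-oo, 1[); last first.
  by apply/seteqP; split => x /=; rewrite in_itv.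
by rewrite -[X in measurable X]setTI; exact: measurable_enorm.
Qed.

Lemma lebesgue_eball_lty : (@lebesgue_rV R n (@eball R n) < +oo)%E.
Proof.
apply: (@le_lt_trans _ _ (@lebesgue_rV R n [set x | forall j, x 0 j \in `[-1, 1]%R])).
  apply: le_measure; rewrite ?inE; [exact: measurable_eball|exact: measurable_rV_cube|].
  move=> x; rewrite /eball/= => x1 j; rewrite in_itv/= -ler_norml.
  rewrite (le_trans _ (ltW x1))// -sqrtr_sqr ler_wsqrtr// (bigD1 j)//= lerDl.
  by apply: sumr_ge0 => k _; exact: sqr_ge0.
rewrite [ltLHS]lebesgue_rV_cube lebesgue_measure_itv/= lte_fin gtrN//.
by rewrite -EFinB -EFin_expe ltry.
Qed.

Lemma lebesgue_eball_gt0 : (0 < @lebesgue_rV R n (@eball R n))%E.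
Proof.
pose c : R := n.+1%:R^-1.
have c0 : 0 < c by rewrite invr_gt0.
apply: (@lt_le_trans _ _ (@lebesgue_rV R n [set x | forall j, x 0 j \in `[0, c]%R])).
  rewrite [ltRHS]lebesgue_rV_cube lebesgue_measure_itv/= lte_fin c0.
  by rewrite -EFinB -EFin_expe lte_fin exprn_gt0// subr0.
apply: le_measure; rewrite ?inE; [exact: measurable_rV_cube|exact: measurable_eball|].
move=> x /= xc; rewrite /eball/= -[ltRHS]sqrtr1 ltr_sqrt//.
apply: (@le_lt_trans _ _ (\sum_(i < n) c)).
  apply: ler_sum => i _; have := xc i; rewrite in_itv/= => /andP[x0 xic].
  rewrite (le_trans _ xic)// expr2 ler_piMl// (le_trans xic)//.
  by rewrite invf_le1// ler1n.
rewrite sumr_const card_ord -mulr_natr mulrC ltr_pdivrMr// mul1r.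
by rewrite ltr_nat.
Qed.

End eball_measure.

Definition sphere (R : realType) (d : nat) : Type :=
  {x : 'rV[R]_d.+1 | enorm x == 1}.

Section sphere_measurable.
Variables (R : realType) (d : nat).

Lemma enorm_delta : enorm (delta_mx 0 0 : 'rV[R]_d.+1) == 1.
Proof.
rewrite /enorm (bigD1 0)//= big1 ?mxE ?eqxx ?expr1n ?addr0 ?sqrtr1// => i i0.
by rewrite mxE (negbTE i0) andbF expr0n.
Qed.

HB.instance Definition _ := SubChoice.on (sphere R d).

HB.instance Definition _ := isPointed.Build (sphere R d)
  (exist (fun x : 'rV[R]_d.+1 => enorm x == 1) _ enorm_delta).

HB.instance Definition _ := Measurable.copy (sphere R d)
  (g_sigma_algebra_preimageType (val : sphere R d -> 'rV[R]_d.+1)).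

Lemma measurable_sphere_val :
  measurable_fun setT (val : sphere R d -> 'rV[R]_d.+1).
Proof. by move=> _ A mA; exists A. Qed.

(* The radial projection x |-> x / |x|. At the origin, a null set, its value is
   the default point of the sphere. *)
Definition radial (x : 'rV[R]_d.+1) : sphere R d :=
  insubd (point : sphere R d) ((enorm x)^-1 *: x).

Lemma measurable_radial : measurable_fun setT radial.
Proof.
suff mr : measurable_fun setT (val \o radial : _ -> 'rV[R]_d.+1).
  by move=> _ _ [A mA <-]; rewrite !setTI -[X in measurable X]setTI; exact: mr.
apply: measurable_rV => i.
pose y (x : 'rV[R]_d.+1) := (enorm x)^-1 *: x.
have my j : measurable_fun setT (fun x => rV_coord j (y x)).
  rewrite (_ : (fun x => _) = (fun x => (enorm x)^-1 * rV_coord j x)).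
    apply: measurable_funM; last exact: measurable_coord.
    rewrite (_ : (fun x => _) = (fun x => powR (enorm x) (-1))).
      apply: (measurableT_comp (f := @powR R ^~ (-1))).
        exact: measurable_powR.
      exact: measurable_enorm.
    by apply/funext => x; rewrite powR_inv1// sqrtr_ge0.
  by apply/funext => x; rewrite /rV_coord mxE.
rewrite (_ : _ \o _ = fun x => if enorm (y x) == 1 then rV_coord i (y x)
  else rV_coord i (delta_mx 0 0)).
  apply: measurable_fun_ifT => //.
  apply: measurable_fun_eqr => //.
  apply: measurableT_comp; first exact: measurable_enorm.
  exact: measurable_rV.
apply/funext => x /=; rewrite /radial val_insubd/=.
by case: ifP.
Qed.

(* Normalized Lebesgue (surface) measure: the measure of A is the proportion of
   the unit ball occupied by the cone over A with apex the origin. *)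
Definition sphere_measure (A : set (sphere R d)) : \bar R :=
  (@lebesgue_rV R d.+1 (radial @^-1` A `&` @eball R d.+1)
     / @lebesgue_rV R d.+1 (@eball R d.+1))%E.

Let ball_fin : @lebesgue_rV R d.+1 (@eball R d.+1) \is a fin_num.
Proof. by rewrite ge0_fin_numE// lebesgue_eball_lty. Qed.

Let ball_neq0 : @lebesgue_rV R d.+1 (@eball R d.+1) != 0%E.
Proof. by rewrite gt_eqF// lebesgue_eball_gt0. Qed.

Let sphere_measure0 : sphere_measure set0 = 0%E.
Proof. by rewrite /sphere_measure preimage_set0 set0I measure0 mul0e. Qed.

Let sphere_measure_ge0 A : (0 <= sphere_measure A)%E.
Proof. by rewrite /sphere_measure mule_ge0// inve_ge0. Qed.

Let sphere_measure_sigma_additive : semi_sigma_additive sphere_measure.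
Proof.
move=> F mF tF mUF; rewrite /sphere_measure.
rewrite [X in X @ _ --> _](_ : _ = (fun n => (\sum_(0 <= i < n)
    lebesgue_rV (radial @^-1` F i `&` @eball R d.+1)) /
    @lebesgue_rV R d.+1 (@eball R d.+1))%E); last first.
  by apply/funext => n; rewrite -ge0_sume_distrl.
have mrF A : measurable A -> measurable (radial @^-1` A `&` @eball R d.+1).
  move=> mA; apply: measurableI; last exact: measurable_eball.
  by rewrite -[X in measurable X]setTI; exact: measurable_radial.
apply: cvgeZr => //.
  by rewrite fin_numV//; move: ball_fin; rewrite fin_numE => /andP[].
rewrite preimage_bigcup setI_bigcupl; apply: measure_semi_sigma_additive.
- by move=> n; exact: mrF.
- apply/trivIsetP => i j _ _ ij; rewrite setIACA -preimage_setI.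
  by move/trivIsetP : tF => /(_ _ _ _ _ ij) ->//; rewrite preimage_set0 set0I.
- by rewrite -setI_bigcupl -preimage_bigcup; exact: mrF.
Qed.

HB.instance Definition _ := isMeasure.Build _ _ _ sphere_measure
  sphere_measure0 sphere_measure_ge0 sphere_measure_sigma_additive.

Let sphere_measureT : sphere_measure setT = 1%E.
Proof.
by rewrite /sphere_measure preimage_setT setTI muleC mulVe.
Qed.

HB.instance Definition _ := @Measure_isProbability.Build _ _ _ sphere_measure
  sphere_measureT.

End sphere_measurable.

(* L^1(mu), i.e. integrable functions modulo equality mu-almost everywhere, is
   the library type LspaceType1 mu, which has no topology there; it is given the
   one induced by the metric |f - g|_1. An element f of LspaceType1 mu is
   applied to points through a representative of its class. *)
Section L1_metric.
Local Open Scope quotient_scope.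
Context d (T : measurableType d) (R : realType).
Variable mu : {measure set T -> \bar R}.

Notation L1 := (LspaceType1 mu).

Definition L1_dist (f g : L1) : R :=
  fine ('N[mu]_1[EFin \o (fun x => f x - g x)%R])%E.

Let mf (f : L1) : measurable_fun setT (f : T -> R).
Proof.
exact: (@measurable_funPT _ _ _ _ (repr (f : {mfun_ mu, T >-> measurableTypeR R}))).
Qed.

Let mfB (f g : L1) : measurable_fun setT (fun x => f x - g x).
Proof. exact: measurable_funB. Qed.

Let Nfin (f g : L1) : 'N[mu]_1[EFin \o (fun x => f x - g x)%R]%E \is a fin_num.
Proof.
rewrite ge0_fin_numE ?Lnorm_ge0//.
have mNg : measurable_fun setT (fun x => - g x) by exact: measurableT_comp.
apply: (le_lt_trans (eminkowski mu (mf f) mNg (lexx _))).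
rewrite lte_add_pinfty//; first exact: (@Lebesgue_finite _ _ _ _ _ _ f).
have := oppe_Lnorm mu (EFin \o (g : T -> R)) 1.
rewrite (_ : (\- (EFin \o g))%E = EFin \o (fun x => - g x)%R) => [->|//].
exact: (@Lebesgue_finite _ _ _ _ _ _ g).
Qed.

Let L1_distxx f : L1_dist f f = 0.
Proof.
rewrite /L1_dist (_ : EFin \o _ = cst 0%E) ?Lnorm0//.
by apply/funext => x /=; rewrite subrr.
Qed.

Let L1_dist_eq0 f g : L1_dist f g = 0 -> f = g.
Proof.
move=> /eqP; rewrite -eqe fineK// => /eqP /Lnorm_eq0_eq0.
have mEfg : measurable_fun setT (EFin \o (fun x => f x - g x)%R).
  exact/measurable_EFinP.
move=> /(_ mEfg lte01) fg0.
have fgae : (f : T -> R) = g %[ae mu].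
  by apply: filterS fg0 => x /(_ I) [] /subr0_eq.
have : (f : {mfun_ mu, T >-> measurableTypeR R}) = g.
  rewrite -[LHS]reprK -[RHS]reprK; apply/eqP; rewrite eqmodE; exact/asboolP.
case: f g {mEfg fg0 fgae} => [f [[pf]]] [g [[pg]]] /= fg.
rewrite -{}fg in pg *.
by rewrite (Prop_irrelevance pf pg).
Qed.

Let L1_distC f g : L1_dist f g = L1_dist g f.
Proof.
rewrite /L1_dist -oppe_Lnorm; congr (fine (Lnorm _ _ _)).
by apply/funext => x /=; rewrite opprB.
Qed.

Let L1_dist_triangle g f h : L1_dist f h <= L1_dist f g + L1_dist g h.
Proof.
rewrite -lee_fin EFinD !fineK//.
apply: le_trans (eminkowski mu (mfB f g) (mfB g h) (lexx _)).
rewrite le_eqVlt; apply/orP; left; apply/eqP; congr Lnorm.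
by apply/funext => x /=; rewrite addrA subrK.
Qed.

HB.instance Definition _ := gen_eqMixin L1.
HB.instance Definition _ := gen_choiceMixin L1.
HB.instance Definition _ := @isMetric.Build R L1 L1_dist
  L1_distxx L1_dist_eq0 L1_distC L1_dist_triangle.

End L1_metric.

Definition residual (T : topologicalType) (A : set T) : Prop :=
  exists2 G : set T, Gdelta_dense G & G `<=` A.

Section poisson.
Variables (R : realType) (d : nat).
Implicit Types (x : 'rV[R]_d.+1) (xi : sphere R d).

Definition poisson_kernel x xi : R :=
  (1 - enorm x ^+ 2) / enorm (x - val xi) ^+ d.+1.

Definition poisson (f : sphere R d -> R) x : R :=
  \int[@sphere_measure R d]_xi (poisson_kernel x xi * f xi).

(* lne 0 = -oo, and the divisor is positive for r close to 1 on the left. *)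
Definition beta_HF (f : sphere R d -> R) xi : \bar R :=
  limf_einf (fun r : R =>
    lne `|poisson f (r *: val xi)|%:E / (- ln (1 - r))%:E)%E 1^'-.

End poisson.

(* Main.v *)
(* If g is bounded then P[g] is bounded on the whole ball, since the integral of
   the Poisson kernel over the sphere is bounded. If f is within (1 - r)^d of g
   in L^1, then |P[f] - P[g]| <= 2 on the sphere of radius r, because the kernel
   is at most 2 (1 - r)^(-d) there. As the bounded functions are dense, choosing
   r close to 1 in terms of n and of the bound on g shows that the f such that
   |P[f](r z)| < (1 - r)^(-1/n) for all z, for some r in (1 - 1/n, 1), contain a
   dense open set. A function f in all of these sets has its lower exponent at
   most 0 at every point. *)
Require Import Defs.
From HB Require Import structures.
From mathcomp Require Import all_boot all_order all_algebra.
From mathcomp Require Import all_classical all_reals all_analysis.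
From mathcomp Require Import measurable_realfun borel_hierarchy.
From mathcomp Require Import ring lra.

Set Implicit Arguments.
Unset Strict Implicit.
Unset Printing Implicit Defensive.

Import Order.TTheory GRing.Theory Num.Theory.
Import numFieldNormedType.Exports HBSimple.

Local Open Scope classical_set_scope.
Local Open Scope ring_scope.

(** * Classes of integrable functions and density of bounded functions in L^1 *)

Section L1_space.
Local Open Scope quotient_scope.
Context d (T : measurableType d) (R : realType).
Variable mu : {measure set T -> \bar R}.
Implicit Types f g : LspaceType1 mu.

Lemma measurable_L1 f : measurable_fun setT (f : T -> R).
Proof.
exact: (@measurable_funPT _ _ _ _ (repr (f : {mfun_ mu, T >-> measurableTypeR R}))).
Qed.

Lemma integrable_L1 f : mu.-integrable setT (EFin \o (f : T -> R)).
Proof.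
apply/integrableP; split; first exact/measurable_EFinP/measurable_L1.
by rewrite -Lnorm1; exact: (@Lebesgue_finite _ _ _ _ _ _ f).
Qed.

Lemma mdist_L1E f g :
  (mdist f g)%:E = (\int[mu]_x `|(f x - g x)%:E|)%E.
Proof.
rewrite -Lnorm1 /mdist/= /L1_dist fineK// ge0_fin_numE ?Lnorm_ge0// Lnorm1.
by have /integrableP[] := integrableB measurableT (integrable_L1 f) (integrable_L1 g).
Qed.

Section class_of_integrable.
Variables (h : T -> R) (ih : mu.-integrable setT (EFin \o h)).

Let mh : h \in @mfun _ _ T (measurableTypeR R).
Proof. by rewrite inE/=; apply/measurable_EFinP; exact: measurable_int ih. Qed.

Definition L1_class : {mfun_ mu, T >-> measurableTypeR R} :=
  \pi_({mfun_ mu, T >-> measurableTypeR R}) (@mfun_Sub d _ T (measurableTypeR R) h mh).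

(** A class is evaluated through a chosen representative, which [h] equals only up to a null set. *)
Lemma L1_class_ae : (L1_class : T -> R) = h %[ae mu].
Proof.
have /eqP : \pi_({mfun_ mu, T >-> measurableTypeR R}) (repr L1_class) = L1_class :=
  reprK _.
by rewrite eqmodE => /asboolP.
Qed.

Let L1_class_finite : finite_norm mu 1 L1_class.
Proof.
rewrite /finite_norm Lnorm1.
rewrite (@ae_eq_integral _ _ _ mu setT (fun x => `|(h x)%:E|)%E)//.
- by case/integrableP : ih.
- apply: measurableT_comp => //; apply/measurable_EFinP.
  exact: (@measurable_funPT _ _ _ _ (repr L1_class)).
- by apply: measurableT_comp => //; exact: measurable_int ih.
- by apply: filterS L1_class_ae => x /= + xT => ->.
Qed.

HB.instance Definition _ :=
  isFinLebesgue.Build _ _ _ mu 1%E (lexx _) L1_class L1_class_finite.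

Definition L1_of_integrable : LspaceType1 mu := L1_class.

End class_of_integrable.

(** Simple functions approximate [f] in L^1 and are bounded; passing to the class keeps the bound
    almost everywhere. *)
Lemma L1_bounded_dense f (e : R) : 0 < e ->
  exists g, exists M, mdist f g < e /\ {ae mu, forall x, `|g x| <= M}.
Proof.
move=> e0.
have [s [is_ _ scvg]] := approximation_sfun_integrable measurableT (integrable_L1 f).
have /fine_cvgP[_] : (fun n => \int[mu]_x `|(f x)%:E - (s n x)%:E|)%E @ \oo --> 0%E.
  exact: scvg.
move=> /cvgrPdist_lt /(_ _ e0)[n _ /(_ n (leqnn n))/=].
rewrite sub0r normrN => nfe.
have [B [_ sB]] := simple_bounded (s n).
(* Boundedness of [s n] is stated as a bound by every number above [B], hence [B + 1]. *)
exists (L1_of_integrable (is_ n)), (B + 1); split.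
  have : (\int[mu]_x `|(f x)%:E - (s n x)%:E| < e%:E)%E.
    rewrite -[X in (X < _)%E]fineK ?lte_fin ?(le_lt_trans (ler_norm _) nfe)//.
    rewrite ge0_fin_numE ?integral_ge0//.
    by have /integrableP[] := integrableB measurableT (integrable_L1 f) (is_ n).
  rewrite -lte_fin mdist_L1E; apply: le_lt_trans; rewrite le_eqVlt.
  apply/orP; left; apply/eqP/ae_eq_integral => //.
  - apply: measurableT_comp => //; apply/measurable_EFinP/measurable_funB.
      exact: measurable_L1.
    exact: measurable_L1.
  - apply: measurableT_comp => //; apply: emeasurable_funB.
      exact/measurable_EFinP/measurable_L1.
    exact: measurable_int (is_ n).
  - by apply: filterS (L1_class_ae (is_ n)) => x /= + xT => ->.
apply: filterS (L1_class_ae (is_ n)) => x /(_ I) /= ->.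
by apply: sB; rewrite ?ltrDl.
Qed.

End L1_space.

(** * Volume of boxes *)

Section lebesgue_box.
Variable R : realType.

Lemma measurable_rV_box n (I : 'I_n -> interval R) :
  measurable [set x : 'rV[R]_n | forall j, x 0 j \in I j].
Proof.
rewrite (_ : mkset _ = \bigcap_(j in [set: 'I_n]) (rV_coord j @^-1` [set` I j])).
  apply: fin_bigcap_measurable => // j _.
  by rewrite -[X in measurable X]setTI; exact: measurable_coord.
by apply/seteqP; split => x Hx j //=; [move=> _; exact: Hx|exact: (Hx j)].
Qed.

(** Induction on the dimension, splitting off the first coordinate. The sides vary with the axis so
    that cubes with arbitrary centers are covered. *)
Lemma lebesgue_rV_box n (I : 'I_n -> interval R) :
  @lebesgue_rV R n [set x | forall j, x 0 j \in I j] =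
  (\prod_(j < n) lebesgue_measure [set` I j])%E.
Proof.
elim: n => [|n IH] in I *.
  by rewrite /= diracE mem_set ?big_ord0//= => -[].
rewrite big_ord_recl -IH -product_measure1E//; last exact: measurable_rV_box.
rewrite /= /pushforward; congr (_ _); apply/seteqP; split => [p /= H|p /= [H1 H2] j].
  split.
    have := H (lshift n (0 : 'I_1)).
    rewrite /rV_cons (row_mxEl (const_mx p.1 : 'rV_1)) mxE.
    by congr (_ \in I _); exact/val_inj.
  move=> j; have := H (rshift 1 j).
  rewrite /rV_cons (row_mxEr (const_mx p.1 : 'rV_1)).
  by congr (_ \in I _); exact/val_inj.
rewrite /rV_cons; case: (@splitP 1 n j) => k jk.
  rewrite (_ : j = lshift n k); last exact/val_inj.
  rewrite (row_mxEl (const_mx p.1 : 'rV_1)) mxE.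
  by rewrite (_ : lshift n k = ord0)//; apply/val_inj => /=; rewrite ord1.
rewrite (_ : j = rshift 1 k); last exact/val_inj.
rewrite (row_mxEr (const_mx p.1 : 'rV_1)).
by rewrite (_ : rshift 1 k = lift ord0 k)//; exact/val_inj.
Qed.

Lemma lebesgue_rV_centered_cube n (c : 'rV[R]_n) (a : R) : 0 <= a ->
  @lebesgue_rV R n [set x | forall j, x 0 j \in `[c 0 j - a, c 0 j + a]] =
  ((a *+ 2) ^+ n)%:E.
Proof.
move=> a0; rewrite lebesgue_rV_box (eq_bigr (fun=> (a *+ 2)%:E)).
  by rewrite prodEFin prodr_const card_ord.
move=> j _; rewrite lebesgue_measure_itv/= lte_fin.
case: ltP => [_|ca]; first by rewrite -EFinB; congr EFin; ring.
by congr EFin; lra.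
Qed.

End lebesgue_box.

(** * The Euclidean norm *)

Section enorm_theory.
Variables (R : realType) (n : nat).
Implicit Types (x y : 'rV[R]_n).

Lemma sum_sqr_ge0 x : 0 <= \sum_i x 0 i ^+ 2.
Proof. by apply: sumr_ge0 => i _; exact: sqr_ge0. Qed.

Lemma enorm_ge0 x : 0 <= enorm x.
Proof. exact: sqrtr_ge0. Qed.

Lemma sqr_enorm x : enorm x ^+ 2 = \sum_i x 0 i ^+ 2.
Proof. by rewrite sqr_sqrtr// sum_sqr_ge0. Qed.

Lemma enormZ (a : R) x : 0 <= a -> enorm (a *: x) = a * enorm x.
Proof.
move=> a0; rewrite /enorm -[in RHS](ger0_norm a0) -sqrtr_sqr -sqrtrM ?sqr_ge0//.
by rewrite mulr_sumr; congr Num.sqrt; apply: eq_bigr => i _; rewrite mxE exprMn.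
Qed.

Lemma le_coord_enorm x i : `|x 0 i| <= enorm x.
Proof.
rewrite -sqrtr_sqr ler_wsqrtr// (bigD1 i)//= lerDl.
by apply: sumr_ge0 => k _; exact: sqr_ge0.
Qed.

Lemma enorm_eq0 x : enorm x = 0 -> x = 0.
Proof.
move=> x0; apply/rowP => i; rewrite mxE; apply/eqP; rewrite -normr_le0 -x0.
exact: le_coord_enorm.
Qed.

End enorm_theory.

(** * Distances to points of the sphere, and first properties of the Poisson kernel *)

Section sphere_theory.
Variables (R : realType) (d : nat).
Implicit Types (x : 'rV[R]_d.+1) (z xi : sphere R d).

Lemma enorm_sphere xi : enorm (val xi) = 1.
Proof. exact/eqP/(valP xi). Qed.

(** Polar decomposition. At the origin the default value of [radial] is multiplied by 0. *)
Lemma radialE x : x = enorm x *: val (radial x).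
Proof.
have [x0|x0] := eqVneq (enorm x) 0; first by rewrite x0 scale0r (enorm_eq0 x0).
rewrite /radial insubdK ?scalerA ?divff ?scale1r//.
by rewrite unfold_in enormZ ?invr_ge0 ?enorm_ge0// mulVf.
Qed.

Lemma sqr_enorm_sphereB (r : R) z xi :
  enorm (r *: val z - val xi) ^+ 2 =
  r * enorm (val z - val xi) ^+ 2 + (1 - r) ^+ 2.
Proof.
have z1 : \sum_i val z 0 i ^+ 2 = 1 by rewrite -sqr_enorm enorm_sphere expr1n.
have xi1 : \sum_i val xi 0 i ^+ 2 = 1 by rewrite -sqr_enorm enorm_sphere expr1n.
rewrite !sqr_enorm.
(* Both unit norms are kept as sums, with coefficients that make the identity hold coordinate by
   coordinate. *)
transitivity (r * \sum_i (val z - val xi) 0 i ^+ 2 +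
    (r ^+ 2 - r) * (\sum_i val z 0 i ^+ 2) + (1 - r) * \sum_i val xi 0 i ^+ 2).
  rewrite !mulr_sumr -!big_split/=; apply: eq_bigr => i _; rewrite !mxE; ring.
by rewrite z1 xi1; ring.
Qed.

Lemma enorm_sphereB_ge (r : R) z xi : 0 <= r <= 1 ->
  1 - r <= enorm (r *: val z - val xi).
Proof.
move=> /andP[r0 r1].
rewrite -(@ler_pXn2r _ 2) ?nnegrE ?enorm_ge0 ?subr_ge0//.
by rewrite sqr_enorm_sphereB lerDr mulr_ge0// sqr_ge0.
Qed.

Lemma enorm_sphereB_le (r : R) z xi : 0 <= r <= 1 ->
  enorm (r *: val z - val xi) <= 2.
Proof.
move=> /andP[r0 r1].
rewrite -(@ler_pXn2r _ 2) ?nnegrE ?enorm_ge0// sqr_enorm.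
(* Coordinatewise (a - b)^2 <= 2 a^2 + 2 b^2, the gap being (a + b)^2. *)
apply: (@le_trans _ _ (2 * r ^+ 2 * (\sum_i val z 0 i ^+ 2) +
    2 * \sum_i val xi 0 i ^+ 2)).
  rewrite !mulr_sumr -!big_split/=; apply: ler_sum => i _; rewrite !mxE.
  rewrite -subr_ge0 [leRHS](_ : _ = (r * val z 0 i + val xi 0 i) ^+ 2) ?sqr_ge0//.
  ring.
by rewrite -!sqr_enorm !enorm_sphere; nra.
Qed.

Lemma measurable_enormB x :
  measurable_fun setT (fun xi : sphere R d => enorm (x - val xi)).
Proof.
apply: measurableT_comp; first exact: measurable_enorm.
apply: measurable_rV => i.
rewrite (_ : _ \o _ = fun xi => x 0 i - rV_coord i (val xi)).
  apply: measurable_funB => //; apply: measurableT_comp; first exact: measurable_coord.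
  exact: measurable_sphere_val.
by apply/funext => xi; rewrite /= /rV_coord !mxE.
Qed.

Lemma measurable_poisson_kernel x :
  measurable_fun setT (poisson_kernel x : sphere R d -> R).
Proof.
rewrite (_ : poisson_kernel x = fun xi => (1 - enorm x ^+ 2) *
    powR (enorm (x - val xi) ^+ d.+1) (-1)); last first.
  by apply/funext => xi; rewrite powR_inv1// exprn_ge0// enorm_ge0.
apply: measurable_funM => //.
apply: (measurableT_comp (f := @powR R ^~ (-1))); first exact: measurable_powR.
exact/measurable_funX/measurable_enormB.
Qed.

Lemma poisson_kernel_ge0 (r : R) z xi : 0 <= r <= 1 ->
  0 <= poisson_kernel (r *: val z) xi.
Proof.
move=> /andP[r0 r1]; rewrite divr_ge0 ?exprn_ge0 ?enorm_ge0//.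
by rewrite subr_ge0 enormZ// enorm_sphere mulr1 exprn_ile1.
Qed.

End sphere_theory.

(** * Measure of spherical caps *)

Section cap_measure.
Variables (R : realType) (d : nat).
Implicit Types (x : 'rV[R]_d.+1) (xi z : sphere R d).
Local Notation sigma := (@sphere_measure R d).

(** The center may lie inside the ball: it will be r z, so that [rho] bounds the distance in the
    denominator of the kernel. *)
Definition cap x (rho : R) : set (sphere R d) :=
  [set xi | enorm (x - val xi) <= rho].

Lemma measurable_cap x rho : measurable (cap x rho).
Proof.
rewrite (_ : cap x rho =
    (fun xi => enorm (x - val xi)) @^-1` [set` `]-oo, rho]]); last first.
  by apply/seteqP; split => xi /=; rewrite in_itv.
by rewrite -[X in measurable X]setTI; exact: measurable_enormB.
Qed.

Definition tube_cube x (rho : R) (k : nat) : set 'rV[R]_d.+1 :=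
  [set y | forall j, y 0 j \in `[((k%:R * rho) *: x) 0 j - rho *+ 2,
                                 ((k%:R * rho) *: x) 0 j + rho *+ 2]].

(* The cone over a cap is contained in the rho-neighbourhood of the segment
   [0, x], which about 1 / rho cubes of side 4 rho centered on the segment
   cover. *)
Lemma cone_cap_sub x (rho : R) : 0 < rho -> enorm x <= 1 ->
  @radial R d @^-1` cap x rho `&` @eball R d.+1 `<=`
  \big[setU/set0]_(k < (Num.trunc rho^-1).+1) tube_cube x rho k.
Proof.
move=> rho0 x1 y [/= xy y1]; rewrite /eball/= in y1.
rewrite -(bigcup_mkord _ (tube_cube x rho)).
set s := enorm y in y1 *; have s0 : 0 <= s by exact: enorm_ge0.
(* The cube containing y has the index k with k rho <= |y| < (k + 1) rho. *)
have /andP[ks sk] : (Num.trunc (s / rho))%:R <= s / rho <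
  (Num.trunc (s / rho)).+1%:R by rewrite truncn_itv// divr_ge0// ltW.
rewrite ler_pdivlMr// in ks; rewrite ltr_pdivrMr// -natr1 mulrDl mul1r in sk.
exists (Num.trunc (s / rho)).
  rewrite /= ltnS; apply/le_truncn/ler_piMl; last exact: ltW.
  by rewrite invr_ge0 ltW.
move=> /= j; rewrite mxE in_itv/= -ler_distlC.
set k := (Num.trunc _)%:R * rho in ks sk *.
have yE : y 0 j = s * val (radial y) 0 j by rewrite [in LHS](radialE y) mxE.
have := le_trans (le_coord_enorm _ j) xy; rewrite !mxE => xyj.
have xj1 := le_trans (le_coord_enorm _ j) x1.
(* Each term is at most rho: the first by the choice of the index and |x| <= 1, the second because s
   < 1 and the projection of y is in the cap. *)
rewrite yE [X in `|X|](_ : _ = - (s - k) * x 0 j + s * (x 0 j - val (radial y) 0 j)).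
  rewrite (le_trans (ler_normD _ _))// mulr2n lerD//.
    rewrite normrM normrN (@ger0_norm _ (s - k)) ?subr_ge0//.
    by rewrite -[leRHS]mulr1 ler_pM ?subr_ge0// lerBlDl ltW.
  by rewrite normrM (@ger0_norm _ s)// -[leRHS]mul1r ler_pM// ltW.
by ring.
Qed.

Definition ball_volume : R := fine (@lebesgue_rV R d.+1 (@eball R d.+1)).

Lemma ball_volumeE : @lebesgue_rV R d.+1 (@eball R d.+1) = ball_volume%:E.
Proof. by rewrite fineK// ge0_fin_numE// lebesgue_eball_lty. Qed.

Lemma ball_volume_gt0 : 0 < ball_volume.
Proof. by rewrite -lte_fin -ball_volumeE lebesgue_eball_gt0. Qed.

(** The summand 1 serves radii at least 1; the other one comes from the volume of the covering
    cubes. *)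
Definition cap_const : R := 1 + 2 * 4 ^+ d.+1 / ball_volume.

Lemma cap_const_ge1 : 1 <= cap_const.
Proof. by rewrite lerDl divr_ge0 ?mulr_ge0 ?exprn_ge0// ltW// ball_volume_gt0. Qed.

(** At most 1 + 1/rho cubes of volume (4 rho)^(d+1) cover the cone over the cap, so its volume is
    O(rho^d) for rho < 1. For larger rho the total mass 1 suffices. *)
Lemma sphere_measure_cap x (rho : R) : 0 < rho -> enorm x <= 1 ->
  (sigma (cap x rho) <= (cap_const * rho ^+ d)%:E)%E.
Proof.
move=> rho0 x1; have [rho1|rho1] := leP 1 rho.
  apply: (le_trans (probability_le1 _ (measurable_cap x rho))).
  by rewrite lee_fin mulr_ege1 ?cap_const_ge1// exprn_ege1.
have v0 := ball_volume_gt0.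
rewrite [leLHS]/sphere_measure ball_volumeE.
rewrite inver gt_eqF//.
rewrite lee_pdivrMr//.
have mcone : measurable (@radial R d @^-1` cap x rho `&` @eball R d.+1).
  apply: measurableI; last exact: measurable_eball.
  rewrite -[X in measurable X]setTI; apply: measurable_radial => //.
  exact: measurable_cap.
apply: (le_trans (@content_subadditive _ _ _ (@lebesgue_rV R d.+1) _ (tube_cube x rho) _
  (fun k _ => @measurable_rV_box _ _ _) mcone (cone_cap_sub rho0 x1))).
rewrite (eq_bigr (fun=> ((rho *+ 4) ^+ d.+1)%:E)); last first.
  move=> k _; rewrite [LHS]lebesgue_rV_centered_cube ?mulrn_wge0 ?(ltW rho0)//.
  by rewrite -mulrnA.
rewrite sumEFin sumr_const card_ord -EFinM lee_fin -[leLHS]mulr_natr -(mulr_natl rho) exprMn.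
have -> : cap_const * rho ^+ d * ball_volume =
    ball_volume * rho ^+ d + 2 * 4 ^+ d.+1 * rho ^+ d.
  by rewrite /cap_const; field; rewrite gt_eqF.
set m := (Num.trunc _).+1%:R.
have mrho : m * rho <= 2.
  rewrite /m -natr1 mulrDl mul1r (natrD _ 1 1) lerD//; last exact: ltW.
  by rewrite -ler_pdivlMr// mul1r truncn_le invr_ge0 ltW.
rewrite [leLHS](_ : _ = 4 ^+ d.+1 * rho ^+ d * (m * rho)); last first.
  by rewrite (exprS rho); ring.
apply: (@le_trans _ _ (4 ^+ d.+1 * rho ^+ d * 2)).
  by rewrite ler_wpM2l// mulr_ge0// exprn_ge0// ltW.
rewrite [leLHS](_ : _ = 2 * 4 ^+ d.+1 * rho ^+ d); last by ring.
by rewrite lerDr mulr_ge0 ?exprn_ge0// ltW.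
Qed.

End cap_measure.

(** * Bounds on the Poisson kernel and the Poisson integral *)

Section poisson_bounds.
Variables (R : realType) (d : nat).
Implicit Types (xi z : sphere R d) (f g : LspaceType1 (@sphere_measure R d)).
Local Notation sigma := (@sphere_measure R d).

(** Used with t = 1 - r and D the distance from r z to xi, to find a dyadic shell containing xi. *)
Lemma dyadic_locate (t D : R) n : 0 <= t -> t <= D -> D <= 2 ^+ n * t ->
  exists2 k, (k < n.+1)%N & 2 ^+ k * t <= D <= 2 ^+ k.+1 * t.
Proof.
move=> t0 tD; elim: n => [|n IH] Dn.
  by exists 0%N; rewrite // expr0 mul1r tD/= expr1 (le_trans Dn)// expr0 ler_wpM2r// ler1n.
have [/IH[k kn kD]|nD] := leP D (2 ^+ n * t); first by exists k => //; exact: ltnW.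
by exists n => //; rewrite (ltW nD).
Qed.

(** The numerator 1 - r^2 is at most 2 (1 - r). The factor [a] is 2^k on the k-th shell, and 1 for
    the bound on the whole sphere. *)
Lemma poisson_kernel_le (r a : R) z xi : 0 <= r < 1 -> 0 < a ->
  a * (1 - r) <= enorm (r *: val z - val xi) ->
  poisson_kernel (r *: val z) xi <= 2 / a ^+ d.+1 / (1 - r) ^+ d.
Proof.
move=> /andP[r0 r1] a0 aD; have t0 : 0 < 1 - r by rewrite subr_gt0.
rewrite /poisson_kernel enormZ// enorm_sphere mulr1.
apply: (@le_trans _ _ (2 * (1 - r) / (a * (1 - r)) ^+ d.+1)).
  rewrite ler_pM ?invr_ge0 ?exprn_ge0 ?enorm_ge0//.
  - by rewrite subr_ge0 exprn_ile1// ltW.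
  - by nra.
  - rewrite lef_pV2 ?posrE ?exprn_gt0 ?mulr_gt0//.
      by rewrite lerXn2r// nnegrE ?enorm_ge0// mulr_ge0// ltW.
    by rewrite (lt_le_trans _ aD)// mulr_gt0.
rewrite exprMn (exprS (1 - r)) le_eqVlt; apply/orP; left; apply/eqP.
by field; rewrite !expf_neq0 ?gt_eqF.
Qed.

Definition poisson_const : R := 4 * 2 ^+ d * cap_const R d.

Lemma poisson_const_ge0 : 0 <= poisson_const.
Proof. by rewrite !mulr_ge0// (le_trans _ (cap_const_ge1 _ _)). Qed.

Lemma sum_geometric_half_le n : \sum_(k < n) (2^-1 : R) ^+ k <= 2.
Proof.
suff -> : \sum_(k < n) (2^-1 : R) ^+ k = 2 - 2 * 2^-1 ^+ n.
  by rewrite gerBl mulr_ge0// exprn_ge0// invr_ge0.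
elim: n => [|n IH]; first by rewrite big_ord0 expr0; ring.
by rewrite big_ord_recr/= IH exprS; field.
Qed.

(* Up to a constant, the kernel is at most [2^(-k(d+1)) (1-r)^(-d)] on the k-th
   dyadic shell around z, whose measure is at most [(2^k (1-r))^d]: the shells
   contribute a geometric series. *)
Lemma integral_poisson_kernel_le (r : R) z : 0 <= r < 1 ->
  (\int[sigma]_xi (poisson_kernel (r *: val z) xi)%:E <= poisson_const%:E)%E.
Proof.
move=> r01; have /andP[r0 r1] := r01; have t0 : 0 < 1 - r by rewrite subr_gt0.
have r01' : 0 <= r <= 1 by rewrite r0 ltW.
set t := 1 - r in t0; set x := r *: val z.
have x1 : enorm x <= 1 by rewrite enormZ// enorm_sphere mulr1 ltW.
(* Enough shells to reach distance 2, since 2^n > n > 2/t. *)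
pose n := (Num.trunc (2 / t)).+1.
have tn : 2 <= 2 ^+ n * t.
  rewrite -ler_pdivrMr// (le_trans (ltW (truncnS_gt _)))//.
  by rewrite -natrX ler_nat ltnW// ltn_expl.
pose rho k : R := 2 ^+ k.+1 * t.
have rho0 k : 0 < rho k by rewrite mulr_gt0// exprn_gt0.
pose a k : R := 2 / (2 ^+ k) ^+ d.+1 / t ^+ d.
have a0 k : 0 <= a k by rewrite !mulr_ge0 ?invr_ge0 ?exprn_ge0// ltW.
apply: (@le_trans _ _ (\int[sigma]_xi
    (\sum_(k < n.+1) (a k)%:E * (\1_(cap x (rho k)) xi)%:E)%E)%E).
  apply: ge0_le_integral => //.
  - by move=> xi _; rewrite lee_fin poisson_kernel_ge0.
  - exact/measurable_EFinP/measurable_poisson_kernel.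
  - apply: emeasurable_sum => k; apply: measurable_funeM.
    exact/measurable_EFinP/measurable_indic/measurable_cap.
  - move=> xi _; pose D := enorm (x - val xi).
    have [k kn /andP[kD Dk]] : exists2 k, (k < n.+1)%N &
        2 ^+ k * t <= D <= 2 ^+ k.+1 * t.
      apply: dyadic_locate; [exact: ltW|exact: enorm_sphereB_ge|].
      exact: le_trans (enorm_sphereB_le _ _ r01') tn.
    (* The term of the shell of xi already dominates the kernel; the others are non-negative. *)
    rewrite (bigD1 (Ordinal kn))//= indicE mem_set//= mule1.
    rewrite -[leLHS]adde0 leeD//.
      by rewrite lee_fin; apply: poisson_kernel_le => //; exact: exprn_gt0.
    by apply: sume_ge0 => j _; rewrite mule_ge0 ?lee_fin.
rewrite ge0_integral_sum//; last 2 first.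
- move=> k; apply: measurable_funeM.
  exact/measurable_EFinP/measurable_indic/measurable_cap.
- by move=> k xi _; rewrite mule_ge0 ?lee_fin.
(* The powers of t cancel between the kernel bound and the cap measure, which makes the estimate
   uniform in r. *)
apply: (@le_trans _ _ (\sum_(k < n.+1)
    (2 * 2 ^+ d * cap_const R d * 2^-1 ^+ k)%:E)%E).
  apply: lee_sum => k _.
  rewrite ge0_integralZl//; last 2 first.
  - exact/measurable_EFinP/measurable_indic/measurable_cap.
  - by rewrite lee_fin.
  rewrite integral_indic//; last exact: measurable_cap.
  rewrite setIT.
  apply: (@le_trans _ _ ((a k)%:E * (cap_const R d * rho k ^+ d)%:E)%E).
    by rewrite lee_wpmul2l ?lee_fin//; exact: sphere_measure_cap.
  rewrite -EFinM lee_fin le_eqVlt; apply/orP; left; apply/eqP.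
  rewrite /a /rho exprMn (exprS 2 k) exprMn exprVn (exprS (2 ^+ k)).
  by field; rewrite !expf_neq0// gt_eqF.
rewrite sumEFin lee_fin -mulr_sumr /poisson_const.
rewrite [leRHS](_ : _ = 2 * 2 ^+ d * cap_const R d * 2); last by ring.
rewrite ler_wpM2l ?sum_geometric_half_le// !mulr_ge0//.
exact: le_trans (cap_const_ge1 _ _).
Qed.

Let kernel_le (r : R) z xi : 0 <= r < 1 ->
  poisson_kernel (r *: val z) xi <= 2 / (1 - r) ^+ d.
Proof.
move=> r01; have /andP[r0 r1] := r01.
have := @poisson_kernel_le r 1 z xi r01 ltr01.
by rewrite expr1n divr1; apply; rewrite mul1r enorm_sphereB_ge// r0 ltW.
Qed.

Lemma integrable_poisson (r : R) z f : 0 <= r < 1 ->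
  sigma.-integrable setT (fun xi => (poisson_kernel (r *: val z) xi * f xi)%:E).
Proof.
move=> r01; have /andP[r0 r1] := r01.
have := integrableZl measurableT (2 / (1 - r) ^+ d) (integrable_L1 f).
apply: le_integrable => //.
  apply/measurable_EFinP/measurable_funM; first exact: measurable_poisson_kernel.
  exact: measurable_L1.
move=> xi _ /=; set c := 2 / _; rewrite lee_fin (normrM (poisson_kernel _ _)) (normrM c) ler_wpM2r//.
rewrite ger0_norm ?poisson_kernel_ge0 ?r0 ?(ltW r1)//.
by rewrite (le_trans _ (ler_norm c))// kernel_le.
Qed.

(** The kernel is at most 2 (1 - r)^(-d) at every xi, so the Lipschitz constant is the same for all
    z. *)
Lemma poisson_lipschitz (r : R) z f g : 0 <= r < 1 ->
  `|poisson f (r *: val z) - poisson g (r *: val z)| <=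
  2 / (1 - r) ^+ d * mdist f g.
Proof.
move=> r01; have /andP[r0 r1] := r01.
have c0 : 0 <= 2 / (1 - r) ^+ d by rewrite divr_ge0 ?exprn_ge0 ?subr_ge0 ?ltW.
have If := integrable_poisson z f r01; have Ig := integrable_poisson z g r01.
rewrite /poisson -RintegralB// -lee_fin EFin_normr_Rintegral//; last first.
  exact: (integrableB measurableT If Ig).
have := integrableB measurableT If Ig => Ifg.
apply: (le_trans (le_abse_integral _ measurableT _)).
  exact: measurable_int Ifg.
rewrite EFinM mdist_L1E.
have mfg : measurable_fun setT (fun xi => `|(f xi - g xi)%:E|%E).
  by apply: measurableT_comp => //; apply/measurable_EFinP/measurable_funB;
    exact: measurable_L1.
rewrite -ge0_integralZl ?lee_fin//.
apply: ge0_le_integral => //.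
- by apply: measurableT_comp => //; exact: measurable_int Ifg.
- exact: measurable_funeM.
- move=> xi _; rewrite -mulrBr lee_fin normrM ler_wpM2r//.
  by rewrite ger0_norm ?kernel_le ?poisson_kernel_ge0 ?r0 ?(ltW r1).
Qed.

(** The kernel is non-negative with integral at most [poisson_const], whatever r and z. *)
Lemma poisson_bounded (r M : R) z f : 0 <= r < 1 ->
  {ae sigma, forall xi, `|f xi| <= M} ->
  `|poisson f (r *: val z)| <= `|M| * poisson_const.
Proof.
move=> r01 fM; have /andP[r0 r1] := r01.
have If := integrable_poisson z f r01.
have P0 xi : 0 <= poisson_kernel (r *: val z) xi.
  by rewrite poisson_kernel_ge0// r0 (ltW r1).
have mP : measurable_fun setT (fun xi => (poisson_kernel (r *: val z) xi)%:E).
  exact/measurable_EFinP/measurable_poisson_kernel.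
rewrite -lee_fin EFin_normr_Rintegral//.
apply: (le_trans (le_abse_integral _ measurableT _)).
  exact: measurable_int If.
apply: (@le_trans _ _ (\int[sigma]_xi
    (`|M|%:E * (poisson_kernel (r *: val z) xi)%:E)%E)%E).
  apply: ae_ge0_le_integral => //.
  - by apply: measurableT_comp => //; exact: measurable_int If.
  - by move=> xi _; rewrite mule_ge0 ?lee_fin.
  - exact: measurable_funeM.
  - apply: filterS fM => xi fM _; rewrite -EFinM lee_fin normrM mulrC.
    by rewrite (ger0_norm (P0 _)) ler_wpM2r// (le_trans fM)// ler_norm.
rewrite ge0_integralZl ?lee_fin//; last by move=> xi _; rewrite lee_fin.
by rewrite EFinM lee_wpmul2l ?lee_fin// integral_poisson_kernel_le.
Qed.

End poisson_bounds.

(** * The dense open sets and the exponent on their intersection *)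

Section residual_set.
Variables (R : realType) (d : nat).
Local Notation sigma := (@sphere_measure R d).
Local Notation L1 := (LspaceType1 (@sphere_measure R d)).

(* [B ^+ n.+1 * (1 - r) <= 1] means [B <= (1 - r) ^ (- 1 / (n + 1))]; the slack
   e makes the set open. *)
Definition slow_growth (n : nat) : set L1 :=
  [set f | exists r B e : R, [/\ 1 - n.+1%:R^-1 < r < 1, 0 < e,
    B ^+ n.+1 * (1 - r) <= 1 &
    forall z : sphere R d, `|poisson f (r *: val z)| + e <= B]].

Lemma slow_growth_radius n (r : R) : 1 - n.+1%:R^-1 < r < 1 -> 0 < r < 1.
Proof.
move=> /andP[nr ->]; rewrite andbT (le_lt_trans _ nr)// subr_ge0.
by rewrite invf_le1// ler1n.
Qed.

(** Only one radius r is involved, and there P[f] is Lipschitz in f uniformly in z: nearby functions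
    keep r and B, with half the slack. *)
Lemma open_slow_growth n : open (slow_growth n).
Proof.
rewrite openE => f [r [B [e [nr e0 Br fB]]]].
have /andP[r0 r1] := slow_growth_radius nr.
pose c := 2 / (1 - r) ^+ d.
have c0 : 0 < c by rewrite divr_gt0// exprn_gt0// subr_gt0.
apply/nbhs_ballP; exists (e / 2 / c) => /=; first by rewrite divr_gt0// divr_gt0.
move=> g; rewrite ballEmdist/= ltr_pdivlMr// => fg.
exists r, B, (e / 2); split => //; [by rewrite divr_gt0|move=> z].
have r01 : 0 <= r < 1 by rewrite (ltW r0) r1.
have := @poisson_lipschitz R d r z f g r01; rewrite -/c => fgr.
have := ler_distD (poisson f (r *: val z)) 0 (poisson g (r *: val z)).
rewrite !sub0r !normrN => gf.
have := fB z; lra.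
Qed.

Lemma dense_slow_growth n : dense (slow_growth n).
Proof.
move=> O [f Of]; rewrite openE => /(_ f Of) /nbhs_ballP[e /= e0 fO].
have [g [M [fg gM]]] := L1_bounded_dense f e0.
exists g; split; first by apply: fO; rewrite ballEmdist.
(* This bound holds at every radius, so r can be chosen after it; the added 1 is the slack. *)
pose B := `|M| * poisson_const R d + 1.
have B0 : 0 <= B by rewrite addr_ge0// mulr_ge0// poisson_const_ge0.
(* This is 1 - r: the term n + 2 puts it below 1/(n+1), the other gives B^(n+1) s <= 1. *)
pose s := (n.+2%:R + B ^+ n.+1)^-1.
have Bn0 : 0 <= B ^+ n.+1 by rewrite exprn_ge0.
have D0 : 0 < n.+2%:R + B ^+ n.+1 by rewrite ltr_wpDr// ltr0n.
have s0 : 0 < s by rewrite invr_gt0.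
have sn : s < n.+1%:R^-1.
  by rewrite ltf_pV2 ?posrE ?ltr0n// ltr_wpDr// ltr_nat.
have r1 : 1 - s < 1 by rewrite gtrBl.
have nr : 1 - n.+1%:R^-1 < 1 - s < 1 by rewrite r1 andbT ltrD2l ltrN2.
have /andP[r0 _] := slow_growth_radius nr.
exists (1 - s), B, 1; split => //; last move=> z.
  by rewrite opprB addrC subrK ler_pdivrMr// mul1r lerDr.
by rewrite lerD2r; apply: poisson_bounded; rewrite // (ltW r0).
Qed.

(** The lower limit is a supremum of infima over left neighbourhoods of 1, and each of these
    contains a radius where the quotient is arbitrarily small or negative. *)
Lemma beta_HF_slow_growth (f : L1) (z : sphere R d) :
  (forall n, slow_growth n f) -> (beta_HF f z <= 0)%E.
Proof.
move=> fU; rewrite /beta_HF limf_einfE.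
apply: ge_ereal_sup => _ [A [e /= e0 eA] <-].
apply/lee_addgt0Pr => eps eps0; rewrite add0e.
(* With 1/(n+1) below both, [e] ensures that r lies in the neighbourhood and [eps] bounds the
   quotient there. *)
pose m := Num.min e eps.
have m0 : 0 < m by rewrite lt_min e0.
pose n := Num.trunc m^-1.
have nm : n.+1%:R^-1 < m.
  by rewrite invf_plt ?posrE ?ltr0n// truncnS_gt.
have [r [B [e' [nr e'0 Br fB]]]] := fU n.
have /andP[r0 r1] := slow_growth_radius nr.
have ne : n.+1%:R^-1 < e by rewrite (lt_le_trans nm)// ge_min lexx.
have neps : n.+1%:R^-1 < eps by rewrite (lt_le_trans nm)// ge_min lexx orbT.
have Ar : A r.
  apply: eA => //=; rewrite ger0_norm ?subr_ge0 ?(ltW r1)//.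
  by case/andP: nr => nr _; rewrite (lt_trans _ ne)// ltrBlDr -ltrBlDl.
apply: (le_trans (ereal_inf_lbound _)); first by exists r.
set p : R := `|poisson f _|.
have L0 : 0 < - ln (1 - r) by rewrite oppr_gt0 ln_lt0// subr_gt0 r1 gtrBl.
rewrite inver gt_eqF// lee_pdivrMr//.
(* If P[f] vanishes at this point, its logarithm is -oo. *)
case: ifPn => [_|]; first by rewrite -EFinM leNye.
rewrite -ltNge -EFinM lee_fin => p0.
have t0 : 0 < 1 - r by rewrite subr_gt0.
have pB : p <= B by have := fB z; rewrite -/p; lra.
(* Taking logarithms then bounds the quotient by 1/(n+1). *)
have : p ^+ n.+1 <= (1 - r)^-1.
  rewrite -[leRHS]mul1r ler_pdivlMr// (le_trans _ Br)// ler_wpM2r ?(ltW t0)//.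
  by rewrite lerXn2r// nnegrE ltW// (lt_le_trans p0).
rewrite -ler_ln ?posrE ?exprn_gt0 ?invr_gt0// lnXn// lnV ?posrE//.
rewrite -mulr_natr -ler_pdivlMr ?ltr0n// => /le_trans; apply.
by rewrite mulrC ler_wpM2r// ltW.
Qed.

End residual_set.

Theorem proposition3p2 (R : realType) (d : nat) (d_ge1 : (1 <= d)%N) :
  residual [set f : LspaceType1 (@sphere_measure R d) |
    forall x : sphere R d, (beta_HF f x <= 0)%E].
Proof.
exists (\bigcap_n @slow_growth R d n).
  by exists (@slow_growth R d) => // n; split;
    [exact: open_slow_growth|exact: dense_slow_growth].
by move=> f fU z; apply: beta_HF_slow_growth => n; exact: fU.
Qed.
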